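(* Let $n,m\geq 1$ be integers and let $A\in\mathbb{R}^{n\times n}$, $B\in\mathbb{R}^{n\times m}$, $Q\in\mathbb{R}^{n\times n}$, $U\in\mathbb{R}^{m\times m}$ be real matrices, with $Q$ and $U$ symmetric positive definite, such that $(A,B)$ satisfies the Kalman condition $\mathrm{rank}(B,AB,\ldots,A^{n-1}B)=n$. Then there exist constants $T_0>0$, $C>0$ and $\nu>0$, depending only on $A,B,Q,U$ (in particular not on $T,x_0,x_1$), such that the following holds for all $x_d\in\mathbb{R}^n$ and $u_d\in\mathbb{R}^m$. For every $T\geq T_0$, for all $x_0,x_1\in\mathbb{R}^n$, and for every $t\in[0,T]$, $$ \Vert x_T(t)-\bar x\Vert + \Vert u_T(t)-\bar u\Vert + \Vert \lambda_T(t)-\bar\lambda\Vert \leq C\big(\Vert x_0-\bar x\Vert+\Vert x_1-\bar x\Vert\big)\big(e^{-\nu t}+e^{-\nu(T-t)}\big), $$ where $(x_T(\cdot),u_T(\cdot))$ is the unique optimal solution, and $\lambda_T(\cdot)$ the associated costate, of the linear-quadratic optimal control problem on $[0,T]$ $$ \min \int_0^T\Big[(x(t)-x_d)^\top Q(x(t)-x_d)+(u(t)-u_d)^\top U(u(t)-u_d)\Big]dt $$ $$ \text{subject to}\quad \dot x(t)=Ax(t)+Bu(t),\quad x(0)=x_0,\quad x(T)=x_1, $$ and $(\bar x,\bar u)$ is the unique minimizer, and $\bar\lambda$ the unique associated (normalized) Lagrange multiplier, of the static problem $$ \min\Big\{(x-x_d)^\top Q(x-x_d)+(u-u_d)^\top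 U(u-u_d)\ \Big|\ (x,u)\in\mathbb{R}^n\times\mathbb{R}^m,\ Ax+Bu=0\Big\}. $$
   Context: The state is $x(t)\in\mathbb{R}^n$ and the control is $u(t)\in\mathbb{R}^m$, with no constraint on the control; controls are taken in $L^2([0,T],\mathbb{R}^m)$ and trajectories are absolutely continuous. $\Vert\cdot\Vert$ denotes the Euclidean norm. Dynamic problem: under the Kalman condition there is, for every $T>0$ and all $x_0,x_1$, a unique optimal pair $(x_T(\cdot),u_T(\cdot))$. The costate (adjoint vector) $\lambda_T(\cdot):[0,T]\to\mathbb{R}^n$ is the map given by the Pontryagin maximum principle, with the cost multiplier normalized to $-1/2$. It is unique and is characterized by $$u_T(t)=u_d+U^{-1}B^\top\lambda_T(t),$$ $$\dot x_T(t)=Ax_T(t)+BU^{-1}B^\top\lambda_T(t)+Bu_d,\qquad \dot\lambda_T(t)=Qx_T(t)-A^\top\lambda_T(t)-Qx_d,$$ for every $t\in[0,T]$, together with $x_T(0)=x_0$ and $x_T(T)=x_1$ (so $u_T$ denotes the continuous representative given by the first formula). These conditions are necessary and sufficient for optimality. Static problem: with the cost multiplier likewise normalized to $-1/2$, $(\bar x,\bar\lambda)$ is the unique solution of $$A\bar x+BU^{-1}B^\top\bar\lambda+Bu_d=0,\qquad Q\bar x-A^\top\bar\lambda-Qx_d=0,$$ and $\bar u=u_d+U^{-1}B^\top\bar\lambda$. *)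

(* Defs.v *)
From HB Require Import structures.
From mathcomp Require Import all_boot all_order all_algebra.
From mathcomp Require Import all_classical all_reals all_analysis.
Import numFieldNormedType.Exports.

Set Implicit Arguments.
Unset Strict Implicit.
Unset Printing Implicit Defensive.
Import Order.TTheory GRing.Theory Num.Theory.
Local Open Scope classical_set_scope.
Local Open Scope ring_scope.

(* The library norm on matrices is the sup norm, hence this definition. *)
Definition enorm (R : realType) (n : nat) (v : 'cV[R]_n) : R :=
  Num.sqrt (\sum_i v i 0 ^+ 2).

Definition qform (R : realType) (n : nat) (M : 'M[R]_n) (v : 'cV[R]_n) : R :=
  (v^T *m M *m v) 0 0.

Definition sym_posdef (R : realType) (n : nat) (M : 'M[R]_n) : Prop :=
  M^T = M /\ forall v : 'cV[R]_n, v != 0 -> 0 < qform M v.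

Definition kalman (R : realType) (n m : nat)
    (A : 'M[R]_n) (B : 'M[R]_(n, m)) : Prop :=
  \rank (\mxrow_(k < n) (A ^+ k *m B)) = n.

(* Derivative at t relative to [0, T]: two-sided inside, one-sided at the
   endpoints. It is taken entry by entry because the library's normed-module
   structure on matrices requires dimensions of the form k.+1. *)
Definition has_deriv_on (R : realType) (n : nat) (T : R)
    (x : R -> 'cV[R]_n) (t : R) (v : 'cV[R]_n) : Prop :=
  forall i, (fun s => (x s i 0 - x t i 0) / (s - t))
    @ within `[0, T] t^' --> v i 0.

Definition abs_continuous_on (R : realType) (n : nat) (T : R)
    (x : R -> 'cV[R]_n) : Prop :=
  forall e : R, 0 < e -> exists2 d : R, 0 < d &
    forall s : seq (R * R),
      all (fun p => (0 <= p.1) && (p.1 <= p.2) && (p.2 <= T)) s ->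
      pairwise (fun p q => (p.2 <= q.1) || (q.2 <= p.1)) s ->
      \sum_(p <- s) (p.2 - p.1) < d ->
      \sum_(p <- s) enorm (x p.2 - x p.1) < e.

Definition L2_control (R : realType) (m : nat) (T : R)
    (u : R -> 'cV[R]_m) : Prop :=
  forall j, measurable_fun `[0, T] (fun t => u t j 0) /\
    (@lebesgue_measure R).-integrable `[0, T]
      (fun t => (u t j 0 ^+ 2)%:E).

Definition admissible (R : realType) (n m : nat)
    (A : 'M[R]_n) (B : 'M[R]_(n, m)) (T : R) (x0 x1 : 'cV[R]_n)
    (x : R -> 'cV[R]_n) (u : R -> 'cV[R]_m) : Prop :=
  [/\ abs_continuous_on T x, L2_control T u,
      {ae @lebesgue_measure R, forall t, 0 <= t <= T ->
         has_deriv_on T x t (A *m x t + B *m u t)},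
      x 0 = x0 & x T = x1].

Definition running_cost (R : realType) (n m : nat)
    (Q : 'M[R]_n) (U : 'M[R]_m) (xd : 'cV[R]_n) (ud : 'cV[R]_m)
    (x : 'cV[R]_n) (u : 'cV[R]_m) : R :=
  qform Q (x - xd) + qform U (u - ud).

Definition cost (R : realType) (n m : nat)
    (Q : 'M[R]_n) (U : 'M[R]_m) (xd : 'cV[R]_n) (ud : 'cV[R]_m) (T : R)
    (x : R -> 'cV[R]_n) (u : R -> 'cV[R]_m) : \bar R :=
  (\int[@lebesgue_measure R]_(t in `[0%R, T])
     (running_cost Q U xd ud (x t) (u t))%:E)%E.

Definition optimal_pair (R : realType) (n m : nat)
    (A : 'M[R]_n) (B : 'M[R]_(n, m)) (Q : 'M[R]_n) (U : 'M[R]_m)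
    (xd : 'cV[R]_n) (ud : 'cV[R]_m) (T : R) (x0 x1 : 'cV[R]_n)
    (x : R -> 'cV[R]_n) (u : R -> 'cV[R]_m) : Prop :=
  admissible A B T x0 x1 x u /\
  forall y v, admissible A B T x0 x1 y v ->
    (cost Q U xd ud T x u <= cost Q U xd ud T y v)%E.

(* Extremal system of the Pontryagin maximum principle, with the multiplier of
   the cost normalized to -1/2. An optimal control is an L^2 class; requiring
   the first equation at every t, and not only almost everywhere, selects its
   continuous representative. *)
Definition costate (R : realType) (n m : nat)
    (A : 'M[R]_n) (B : 'M[R]_(n, m)) (Q : 'M[R]_n) (U : 'M[R]_m)
    (xd : 'cV[R]_n) (ud : 'cV[R]_m) (T : R)
    (x : R -> 'cV[R]_n) (u : R -> 'cV[R]_m) (l : R -> 'cV[R]_n) : Prop :=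
  forall t, 0 <= t <= T ->
    [/\ u t = ud + invmx U *m B^T *m l t,
        has_deriv_on T x t (A *m x t + B *m invmx U *m B^T *m l t + B *m ud) &
        has_deriv_on T l t (Q *m x t - A^T *m l t - Q *m xd)].

Definition static_minimizer (R : realType) (n m : nat)
    (A : 'M[R]_n) (B : 'M[R]_(n, m)) (Q : 'M[R]_n) (U : 'M[R]_m)
    (xd : 'cV[R]_n) (ud : 'cV[R]_m) (x : 'cV[R]_n) (u : 'cV[R]_m) : Prop :=
  A *m x + B *m u = 0 /\
  forall y v, A *m y + B *m v = 0 ->
    running_cost Q U xd ud x u <= running_cost Q U xd ud y v.

(* Lagrange conditions, with the multiplier of the cost normalized to -1/2. *)
Definition static_multiplier (R : realType) (n m : nat)
    (A : 'M[R]_n) (B : 'M[R]_(n, m)) (Q : 'M[R]_n) (U : 'M[R]_m)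
    (xd : 'cV[R]_n) (ud : 'cV[R]_m)
    (x : 'cV[R]_n) (u : 'cV[R]_m) (l : 'cV[R]_n) : Prop :=
  [/\ A *m x + B *m invmx U *m B^T *m l + B *m ud = 0,
      Q *m x - A^T *m l - Q *m xd = 0 &
      u = ud + invmx U *m B^T *m l].

(* Main.v *)
Require Import Defs.
From HB Require Import structures.
From mathcomp Require Import all_boot all_order all_algebra.
From mathcomp Require Import all_classical all_reals all_analysis.
From mathcomp Require Import ring lra.
Import numFieldNormedType.Exports.
Import Order.TTheory GRing.Theory Num.Theory.
Set Implicit Arguments.
Unset Strict Implicit.
Unset Printing Implicit Defensive.
Local Open Scope classical_set_scope.
Local Open Scope ring_scope.

(** Put [y = x_T - xbar] and [p = lambda_T - lbar]. Then [z = (y, p)] solves the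
    linear system [y' = A y + G p], [p' = Q y - A^T p] with
    [G = B U^-1 B^T], and the pairing [V = y^T p] is nondecreasing because
    [V' = y^T Q y + p^T G p].
    - If [V 1 = V 0] for a solution on [[0, 1]], then [y = 0] and [B^T p = 0];
      differentiating gives [B^T (A^T)^k p = 0] for all [k], so [p = 0] by the
      Kalman condition. Solutions on [[0, 1]] form a finite-dimensional space, so
      compactness turns this into [c |z s|^2 <= V (a + 1) - V a] for
      [a <= s <= a + 1], with [c] independent of the solution and of [a].
    - As [|V| <= |z|^2], it follows that [V a <= V (a + 1) / (1 + c)] where
      [0 <= V], and symmetrically backward where [V <= 0]: the positive part of
      [V] decays geometrically away from [T], the negative part away from [0],
      and [|z|^2] is controlled by the increments of [V].
    - At the ends, [c |z 0|^2] and [c |z T|^2] are at most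
      [V T - V 0 = y(T)^T p(T) - y(0)^T p(0)], which is linear in [p], so Young's
      inequality bounds [|z 0|] and [|z T|] by [|y 0| + |y T|]. *)

(** * One-sided scalar derivatives on [[0, T]] *)

(* [has_deriv_on T x t v] unfolds to [deriv_on] of every entry of [x]. *)
Definition deriv_on (R : realType) (T : R) (f : R -> R) (t v : R) : Prop :=
  (fun s => (f s - f t) / (s - t)) @ within `[0, T] t^' --> v.

Section DerivOn.
Variables (R : realType) (T : R).
Implicit Types (f g : R -> R) (t v w : R).

(** Clearing the denominator makes the estimate hold at [s = t] as well, which removes the punctured
    neighbourhood from later arguments. *)
Lemma deriv_onP f t v :
  deriv_on T f t v <-> forall e, 0 < e -> exists2 d, 0 < d &
    forall s, 0 <= s <= T -> `|s - t| < d ->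
      `|f s - f t - v * (s - t)| <= e * `|s - t|.
Proof.
split=> [fv e e0|fv].
  have /cvgrPdist_le/(_ e e0) := fv; rewrite near_withinE => -[d /= d0 dP].
  exists d => // s s0T st; have [->|st0] := eqVneq s t.
    by rewrite !subrr mulr0 subrr normr0 mulr0.
  have /= := dP s; rewrite /ball /= distrC => /(_ st st0).
  rewrite in_itv /= => /(_ s0T).
  have nz : s - t != 0 by rewrite subr_eq0.
  have -> : f s - f t - v * (s - t) = - (v - (f s - f t) / (s - t)) * (s - t).
    by field.
  by rewrite normrM normrN => h; rewrite ler_wpM2r.
apply/cvgrPdist_le => e e0; have [d d0 dP] := fv e e0.
rewrite near_withinE; exists d => //= s /=; rewrite distrC => st st0.
rewrite in_itv /= => s0T; have := dP s s0T st.
have nz : s - t != 0 by rewrite subr_eq0.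
have -> : f s - f t - v * (s - t) = - (v - (f s - f t) / (s - t)) * (s - t).
  by field.
by rewrite normrM normrN ler_pM2r ?normr_gt0.
Qed.

Lemma deriv_on_ext f g t v : 0 <= t <= T ->
  (forall s, 0 <= s <= T -> f s = g s) -> deriv_on T f t v -> deriv_on T g t v.
Proof.
move=> t0T fg /deriv_onP fv; apply/deriv_onP => e e0.
have [d d0 dP] := fv e e0; exists d => // s s0T st.
by rewrite -!fg //; exact: dP.
Qed.

Lemma deriv_on_continuous f t v :
  deriv_on T f t v -> f @ within `[0, T] (nbhs t) --> f t.
Proof.
move=> /deriv_onP fv; apply/cvgrPdist_le => e e0.
have [d d0 dP] := fv 1 ltr01.
have k0 : 0 < `|v| + 1 by rewrite ltr_wpDl.
have m0 : 0 < Num.min d (e / (`|v| + 1)) by rewrite lt_min d0 divr_gt0.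
rewrite near_withinE; exists (Num.min d (e / (`|v| + 1))) => //= s /=.
rewrite distrC lt_min => /andP[st1 st2]; rewrite in_itv /= => s0T.
rewrite distrC.
have -> : f s - f t = (f s - f t - v * (s - t)) + v * (s - t) by ring.
rewrite (le_trans (ler_normD _ _)) // normrM.
apply: (@le_trans _ _ ((`|v| + 1) * `|s - t|)).
  by rewrite mulrDl addrC lerD2l dP.
by rewrite mulrC -ler_pdivlMr // ltW.
Qed.

Lemma deriv_on_cst (c t : R) : deriv_on T (fun=> c) t 0.
Proof.
apply/deriv_onP => e e0; exists 1 => // s _ _.
by rewrite subrr mul0r subrr normr0 mulr_ge0 // ltW.
Qed.

Lemma deriv_onD f g t v w : deriv_on T f t v -> deriv_on T g t w ->
  deriv_on T (fun s => f s + g s) t (v + w).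
Proof.
move=> fv gw; rewrite /deriv_on; under eq_fun do rewrite opprD addrACA mulrDl.
exact: cvgD fv gw.
Qed.

Lemma deriv_onM f g t v w : deriv_on T f t v -> deriv_on T g t w ->
  deriv_on T (fun s => f s * g s) t (v * g t + f t * w).
Proof.
move=> fv gw; rewrite /deriv_on.
have -> : (fun s => (f s * g s - f t * g t) / (s - t)) =
  (fun s => (f s - f t) / (s - t) * g s + f t * ((g s - g t) / (s - t))).
  by apply/funext => s; ring.
apply: cvgD; last exact: cvgMr.
apply: cvgM; first exact: fv.
apply: cvg_trans (deriv_on_continuous gw).
by apply: cvg_app => P; apply: nbhs_dnbhs.
Qed.

Lemma deriv_onZ (c : R) f t v :
  deriv_on T f t v -> deriv_on T (fun s => c * f s) t (c * v).
Proof.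
move=> fv; have := deriv_onM (deriv_on_cst c t) fv.
by rewrite mul0r add0r.
Qed.

Lemma deriv_on_sum (I : finType) (F : I -> R -> R) (V : I -> R) t :
  (forall i, deriv_on T (F i) t (V i)) ->
  deriv_on T (fun s => \sum_i F i s) t (\sum_i V i).
Proof.
move=> FV; elim: (index_enum I) => [|i r IH].
  by under eq_fun do rewrite big_nil; rewrite big_nil; exact: deriv_on_cst.
under eq_fun do rewrite big_cons; rewrite big_cons.
exact: deriv_onD.
Qed.

Lemma deriv_on_is_derive f t v :
  0 < t < T -> deriv_on T f t v -> is_derive t 1 f v.
Proof.
move=> /andP[t0 tT] /deriv_onP fv.
have lim : h^-1 *: ((f \o shift t) (h *: 1) - f t) @[h --> 0^'] --> v.
  apply/cvgrPdist_le => e e0; have [d d0 dP] := fv e e0.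
  have m0 : 0 < Num.min d (Num.min t (T - t)) by rewrite !lt_min d0 t0 subr_gt0.
  exists (Num.min d (Num.min t (T - t))) => //= h /=.
  rewrite sub0r normrN !lt_min => /and3P[hd ht hT] h0.
  have hs : 0 <= h + t <= T.
    move: ht hT; rewrite !ltr_norml => /andP[? ?] /andP[? ?].
    by apply/andP; lra.
  have := dP (h + t) hs; rewrite addrK => /(_ hd).
  rewrite /shift /= /GRing.scale /= mulr1.
  have -> : f (h + t) - f t - v * h = - (v - h^-1 * (f (h + t) - f t)) * h.
    by field.
  by rewrite normrM normrN ler_pM2r ?normr_gt0.
by split; [apply/cvg_ex; exists v|apply: cvg_lim].
Qed.

Lemma is_derive_deriv_on f t v : is_derive t 1 f v -> deriv_on T f t v.
Proof.
move=> [/cvg_ex[l fl] fE].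
have lv : l = v by rewrite -fE; apply/esym/cvg_lim.
move: fl; rewrite lv => /cvgrPdist_le fv; apply/deriv_onP => e e0.
have [d /= d0 dP] := fv e e0; exists d => // s _ st.
have [->|st0] := eqVneq s t; first by rewrite !subrr mulr0 subrr normr0 mulr0.
have nz : s - t != 0 by rewrite subr_eq0.
have := dP (s - t); rewrite /= sub0r normrN => /(_ st nz).
rewrite /shift /= /GRing.scale /= mulr1 subrK.
have -> : f s - f t - v * (s - t) = - (v - (s - t)^-1 * (f s - f t)) * (s - t).
  by field.
by move=> h; rewrite normrM normrN ler_wpM2r.
Qed.

Lemma deriv_on_nondecreasing f (df : R -> R) :
  (forall t, 0 <= t <= T -> deriv_on T f t (df t)) ->
  (forall t, 0 <= t <= T -> 0 <= df t) ->
  forall s t, 0 <= s -> s <= t -> t <= T -> f s <= f t.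
Proof.
move=> fd df0 s t s0 st tT.
have fD x : x \in `]0, T[ -> is_derive x 1 f (df x).
  rewrite in_itv /= => /andP[x0 xT]; apply: deriv_on_is_derive.
    by rewrite x0 xT.
  by apply: fd; rewrite !ltW.
apply: (@ger0_derive1_ndecr _ f 0 T) => //.
- by move=> x /fD[].
- move=> x xT; rewrite derive1E; have [_ ->] := fD x xT.
  by apply: df0; move: xT; rewrite in_itv /= => /andP[? ?]; rewrite !ltW.
- apply/subspace_continuousP => x /=; rewrite in_itv /= => x0T.
  exact: deriv_on_continuous (fd x x0T).
Qed.

(** Otherwise the tolerance [|v| / 2] applied to the zero increment from [t] to [t + h] would give
    [|v| <= |v| / 2]. *)
Lemma deriv_on_cst_eq0 f t v (c : R) : 0 < t < T ->
  (forall s, 0 < s < T -> f s = c) -> deriv_on T f t v -> v = 0.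
Proof.
move=> tT fc /deriv_onP fv; have /andP[t0 tT'] := tT.
apply/eqP/negPn/negP => v0.
have e0 : 0 < `|v| / 2 by rewrite divr_gt0 ?normr_gt0.
have [d d0 dP] := fv _ e0.
(* The halves keep [h < d] and [t + h < T] strictly. *)
pose h := Num.min (d / 2) ((T - t) / 2).
have h0 : 0 < h by rewrite lt_min !divr_gt0 ?subr_gt0.
have [hd hT] : h <= d / 2 /\ h <= (T - t) / 2 by rewrite !ge_min !lexx orbT.
have := dP (t + h); rewrite addrAC subrr add0r (gtr0_norm h0).
rewrite !fc //; last by apply/andP; lra.
rewrite subrr sub0r normrN normrM (gtr0_norm h0) ler_pM2r //.
have v1 : 0 < `|v| by rewrite normr_gt0.
have hs : 0 <= t + h <= T by apply/andP; lra.
have hd' : h < d by lra.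
move=> /(_ hs hd'); lra.
Qed.

End DerivOn.

Lemma deriv_on_shift (R : realType) (T S a : R) (f : R -> R) (t v : R) :
  0 <= a -> a + S <= T -> deriv_on T f (a + t) v ->
  deriv_on S (fun s => f (a + s)) t v.
Proof.
move=> a0 aS /deriv_onP fv; apply/deriv_onP => e e0.
have [d d0 dP] := fv e e0; exists d => // s /andP[s0 sS] st.
have E : a + s - (a + t) = s - t by ring.
by have := dP (a + s); rewrite E; apply=> //; apply/andP; lra.
Qed.

(** * Quadratic forms *)

Section Forms.
Variable R : realType.

Lemma enorm_ge0 n (v : 'cV[R]_n) : 0 <= enorm v.
Proof. exact: sqrtr_ge0. Qed.

Lemma sqr_enorm n (v : 'cV[R]_n) : enorm v ^+ 2 = \sum_i v i 0 ^+ 2.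
Proof. by rewrite sqr_sqrtr // sumr_ge0 // => i _; exact: sqr_ge0. Qed.

Lemma enorm_eq0 n (v : 'cV[R]_n) : enorm v = 0 -> v = 0.
Proof.
move=> v0; have := sqr_enorm v; rewrite v0 expr0n /= => /esym/eqP.
rewrite psumr_eq0 => [/allP vi|i _]; last exact: sqr_ge0.
apply/matrixP => i j; rewrite ord1 mxE; apply/eqP.
by have := vi i (mem_index_enum i); rewrite sqrf_eq0.
Qed.

Lemma mul_rowcolE n (u v : 'cV[R]_n) : (u^T *m v) 0 0 = \sum_i u i 0 * v i 0.
Proof. by rewrite mxE; apply: eq_bigr => i _; rewrite mxE. Qed.

Lemma bilinE m n (u : 'cV[R]_m) (S : 'M[R]_(m, n)) (v : 'cV[R]_n) :
  (u^T *m S *m v) 0 0 = \sum_j \sum_i u i 0 * S i j * v j 0.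
Proof.
rewrite mxE; apply: eq_bigr => j _; rewrite mxE mulr_suml.
by apply: eq_bigr => i _; rewrite mxE.
Qed.

Lemma sqr_enorm_qform n (v : 'cV[R]_n) : enorm v ^+ 2 = qform 1%:M v.
Proof.
rewrite /qform mulmx1 mul_rowcolE sqr_enorm.
by apply: eq_bigr => i _; rewrite expr2.
Qed.

Lemma qform_mulmx m n (S : 'M[R]_m) (F : 'M[R]_(m, n)) (v : 'cV[R]_n) :
  qform S (F *m v) = qform (F^T *m S *m F) v.
Proof. by rewrite /qform trmx_mul !mulmxA. Qed.

Lemma qform0 n (S : 'M[R]_n) : qform S 0 = 0.
Proof. by rewrite /qform mulmx0 mxE. Qed.

Lemma qformB n (S S' : 'M[R]_n) (v : 'cV[R]_n) :
  qform (S - S') v = qform S v - qform S' v.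
Proof. by rewrite /qform mulmxBr mulmxBl !mxE. Qed.

Lemma qformZv n (S : 'M[R]_n) (c : R) (v : 'cV[R]_n) :
  qform S (c *: v) = c ^+ 2 * qform S v.
Proof.
rewrite /qform.
have -> : (c *: v)^T = c *: v^T by apply/matrixP => i j; rewrite !mxE.
by rewrite -!scalemxAl -scalemxAr scalerA -expr2 mxE.
Qed.

Lemma qform_bound n (S : 'M[R]_n) :
  exists2 K, 0 < K & forall v, `|qform S v| <= K * enorm v ^+ 2.
Proof.
(* Each coordinate is at most [enorm v]; the summand 1 keeps the constant positive when [S = 0]. *)
exists (1 + \sum_j \sum_i `|S i j|).
  by rewrite ltr_pwDl // sumr_ge0 // => j _; rewrite sumr_ge0.
move=> v; rewrite mulrDl ler_wpDl ?mul1r ?sqr_ge0 // /qform bilinE.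
rewrite (le_trans (ler_norm_sum _ _ _)) // mulr_suml ler_sum // => j _.
rewrite (le_trans (ler_norm_sum _ _ _)) // mulr_suml ler_sum // => i _.
have coord k : `|v k 0| <= enorm v.
  rewrite -sqrtr_sqr ler_wsqrtr // (bigD1 k) //= ler_wpDr //.
  by rewrite sumr_ge0 // => l _; exact: sqr_ge0.
rewrite !normrM mulrAC mulrC expr2.
by rewrite ler_wpM2l // ler_pM.
Qed.

Lemma enorm_mulmx_bound m n (F : 'M[R]_(m, n)) :
  exists2 K, 0 < K & forall v, enorm (F *m v) <= K * enorm v.
Proof.
have [K K0 KP] := qform_bound (F^T *m F).
exists (Num.sqrt K); first by rewrite sqrtr_gt0.
move=> v; rewrite -(@ler_pXn2r _ 2) ?nnegrE ?mulr_ge0 ?enorm_ge0 ?sqrtr_ge0 //.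
rewrite exprMn (sqr_sqrtr (ltW K0)) sqr_enorm_qform qform_mulmx mulmx1.
exact: le_trans (ler_norm _) (KP v).
Qed.

Lemma qform_continuous n (S : 'M[R]_n) :
  continuous (fun v : 'rV[R]_n => qform S v^T).
Proof.
have -> : (fun v : 'rV[R]_n => qform S v^T) =
    (fun v => \sum_j \sum_i v 0 i * S i j * v 0 j).
  by apply/funext => v; rewrite /qform bilinE; under eq_bigr => j _ do
    under eq_bigr => i _ do rewrite !mxE.
have addc := @add_continuous R^o.
apply: (continuous_big addc) => j _; apply: (continuous_big addc) => i _ v.
have coord k : (w : 'rV[R]_n) 0 k @[w --> v] --> v 0 k.
  exact: coord_continuous.
exact: cvgM (cvgM (coord i) (cvg_cst (S i j))) (coord j).
Qed.

(** The constant is the minimum of the form on the compact Euclidean unit sphere; homogeneity of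
    degree 2 extends the bound to all vectors. *)
Lemma qform_coercive n (S : 'M[R]_n) :
  (forall v, v != 0 -> 0 < qform S v) ->
  exists2 c, 0 < c & forall v, c * enorm v ^+ 2 <= qform S v.
Proof.
move=> Spos.
pose sphere := [set v : 'rV[R]_n | qform 1%:M v^T = 1].
have normalize (v : 'cV[R]_n) : v != 0 -> sphere ((enorm v)^-1 *: v)^T.
  move=> v0; rewrite /sphere /= trmxK qformZv -sqr_enorm_qform -exprMn.
  rewrite mulVf ?expr1n //; apply: contra_neq v0; exact: enorm_eq0.
(* An empty sphere means that 0 is the only vector, and any constant works. *)
have [[w wS]|noS] := pselect (sphere !=set0); last first.
  exists 1 => // v; have [->|v0] := eqVneq v 0.
    by rewrite sqr_enorm_qform !qform0 mulr0.
  by case: noS; exists ((enorm v)^-1 *: v)^T; exact: normalize.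
have cS : compact sphere.
  apply: bounded_closed_compact.
    exists 1; split => // M M1 v vS /=; apply: le_trans (ltW M1).
    rewrite [leLHS]/Num.norm /= mx_normrE; apply: bigmax_le => // -[i j] _ /=.
    have := vS; rewrite /sphere /= -sqr_enorm_qform sqr_enorm => E.
    rewrite -[leLHS]ger0_norm // -sqrtr_sqr -[leRHS]sqrtr1 ler_wsqrtr //.
    rewrite -E (bigD1 j) //= real_normK ?num_real // mxE !ord1 ler_wpDr //.
    by rewrite sumr_ge0 // => k _; exact: sqr_ge0.
  have /continuous_closedP := @qform_continuous n 1%:M.
  by move/(_ _ (@closed_eq _ _)); exact.
have [c cS1 cmin] := EVT_min_rV (ex_intro _ w wS) cS
  (continuous_subspaceT (@qform_continuous n S)).
have c0 : c^T != 0.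
  apply/eqP => c0; move: cS1; rewrite inE /sphere /= c0 /qform mulmx0 mxE.
  by move=> /esym/eqP; rewrite oner_eq0.
exists (qform S c^T); first exact: Spos.
move=> v; have [->|v0] := eqVneq v 0.
  by rewrite sqr_enorm_qform !qform0 mulr0.
have := cmin _ (mem_set (normalize v v0)); rewrite trmxK qformZv exprVn.
have e0 : 0 < enorm v ^+ 2.
  rewrite exprn_gt0 // lt_def enorm_ge0 andbT.
  by apply: contra_neq v0; exact: enorm_eq0.
by rewrite mulrC ler_pdivlMr.
Qed.

Lemma posdef_unitmx n (S : 'M[R]_n) : sym_posdef S -> S \in unitmx.
Proof.
move=> [Ssym Spos]; rewrite -row_free_unit; apply: inj_row_free => v vS.
apply/eqP/negPn/negP => v0.
have : 0 < qform S v^T by apply: Spos; rewrite trmx_eq0.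
by rewrite /qform trmxK vS mul0mx mxE ltxx.
Qed.

End Forms.

(** * Linear differential systems *)

Definition linear_sol (R : realType) (T : R) (n : nat) (M : 'M[R]_n)
    (z : R -> 'cV[R]_n) : Prop :=
  forall t, 0 <= t <= T -> has_deriv_on T z t (M *m z t).

Section LinearSol.
Variables (R : realType) (T : R).

Lemma has_deriv_on_bilin m n (x : R -> 'cV[R]_m) (S : 'M[R]_(m, n))
    (y : R -> 'cV[R]_n) t v w :
  has_deriv_on T x t v -> has_deriv_on T y t w ->
  deriv_on T (fun s => ((x s)^T *m S *m y s) 0 0) t
    ((v^T *m S *m y t) 0 0 + ((x t)^T *m S *m w) 0 0).
Proof.
move=> xv yw; under eq_fun do rewrite bilinE.
rewrite !bilinE -big_split /=; apply: deriv_on_sum => j.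
rewrite -big_split /=; apply: deriv_on_sum => i.
rewrite [v i 0 * _]mulrC [x t i 0 * S i j]mulrC.
under eq_fun do rewrite [_ * S i j]mulrC.
have xi : deriv_on T (fun s => x s i 0) t (v i 0) := xv i.
have yj : deriv_on T (fun s => y s j 0) t (w j 0) := yw j.
exact: deriv_onM (deriv_onZ xi) yj.
Qed.

Lemma has_deriv_on_mulmx m n (F : 'M[R]_(m, n)) (x : R -> 'cV[R]_n) t v :
  has_deriv_on T x t v -> has_deriv_on T (fun s => F *m x s) t (F *m v).
Proof.
move=> xv i; rewrite -/(deriv_on T (fun s => (F *m x s) i 0) t _) mxE.
under eq_fun do rewrite mxE; apply: deriv_on_sum => j.
by apply: deriv_onZ; exact: xv.
Qed.

Lemma has_deriv_onD n (x y : R -> 'cV[R]_n) t v w :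
  has_deriv_on T x t v -> has_deriv_on T y t w ->
  has_deriv_on T (fun s => x s + y s) t (v + w).
Proof.
move=> xv yw i; rewrite -/(deriv_on T (fun s => (x s + y s) i 0) t _) mxE.
by under eq_fun do rewrite mxE; apply: deriv_onD; [exact: xv|exact: yw].
Qed.

Variables (n : nat) (M : 'M[R]_n).
Implicit Types (z : R -> 'cV[R]_n).

Lemma linear_sol_qform (S : 'M[R]_n) z t : 0 <= t <= T -> linear_sol T M z ->
  deriv_on T (fun s => qform S (z s)) t (qform (M^T *m S + S *m M) (z t)).
Proof.
move=> t0T zM.
have -> : qform (M^T *m S + S *m M) (z t) =
    ((M *m z t)^T *m S *m z t) 0 0 + ((z t)^T *m S *m (M *m z t)) 0 0.
  by rewrite /qform trmx_mul mulmxDr mulmxDl !mulmxA mxE.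
exact: has_deriv_on_bilin (zM t t0T) (zM t t0T).
Qed.

Lemma linear_solD z1 z2 (a : R) : linear_sol T M z1 -> linear_sol T M z2 ->
  linear_sol T M (fun s => z1 s + a *: z2 s).
Proof.
move=> z1M z2M t t0T; rewrite mulmxDr -scalemxAr -[a *: (M *m _)]mul_scalar_mx.
have -> : (fun s => z1 s + a *: z2 s) = (fun s => z1 s + a%:M *m z2 s).
  by apply/funext => s; rewrite mul_scalar_mx.
exact: has_deriv_onD (z1M t t0T) (has_deriv_on_mulmx (z2M t t0T)).
Qed.

End LinearSol.

Lemma deriv_on_expR (R : realType) (T c t : R) :
  deriv_on T (fun s => expR (c * s)) t (c * expR (c * t)).
Proof.
apply: is_derive_deriv_on.
have h : is_derive t 1 (c \*: id) (c *: (1 : R)) by exact: is_deriveZ.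
have := @is_derive1_comp _ expR (c \*: id) t _ _ (is_derive_expR _) h.
by rewrite /GRing.scale /= mulr1 mulrC.
Qed.

(** A two-sided Gronwall estimate: the derivative of [|z|^2] is a quadratic form bounded by
    [K |z|^2], so [exp(K t) |z|^2] is nondecreasing and [exp(- K t) |z|^2] is nonincreasing. It also
    yields uniqueness, from any starting time. *)
Lemma linear_sol_growth (R : realType) (n : nat) (M : 'M[R]_n) :
  exists2 K, 0 < K & forall (T : R) z, linear_sol T M z ->
    forall s t, 0 <= s <= T -> 0 <= t <= T ->
    enorm (z t) ^+ 2 <= expR (K * T) * enorm (z s) ^+ 2.
Proof.
have [K K0 KP] := qform_bound (M^T *m 1%:M + 1%:M *m M).
exists K => // T z zM.
pose N t := enorm (z t) ^+ 2.
have N0 t : 0 <= N t by exact: sqr_ge0.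
have dN t : 0 <= t <= T ->
    deriv_on T N t (qform (M^T *m 1%:M + 1%:M *m M) (z t)).
  move=> t0T; have -> : N = fun s => qform 1%:M (z s).
    by apply/funext => s; rewrite /N sqr_enorm_qform.
  exact: linear_sol_qform.
pose q t := qform (M^T *m 1%:M + 1%:M *m M) (z t).
have qN t : - (K * N t) <= q t <= K * N t by rewrite -ler_norml; exact: KP.
have up s t : 0 <= s -> s <= t -> t <= T ->
    expR (K * s) * N s <= expR (K * t) * N t.
  apply: (@deriv_on_nondecreasing _ T (fun r => expR (K * r) * N r)
    (fun r => K * expR (K * r) * N r + expR (K * r) * q r)) => r r0T.
    exact: deriv_onM (@deriv_on_expR _ T K r) (dN r r0T).
  rewrite mulrAC mulrC -mulrDr mulr_ge0 ?expR_ge0 //.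
  by have := qN r; lra.
have down s t : 0 <= s -> s <= t -> t <= T ->
    expR (- K * t) * N t <= expR (- K * s) * N s.
  move=> s0 st tT; rewrite -lerN2 -[leLHS]mulN1r -[leRHS]mulN1r.
  apply: (@deriv_on_nondecreasing _ T (fun r => -1 * (expR (- K * r) * N r))
    (fun r => -1 * (- K * expR (- K * r) * N r + expR (- K * r) * q r))) => //.
    move=> r r0T; apply: deriv_onZ.
    exact: deriv_onM (@deriv_on_expR _ T (- K) r) (dN r r0T).
  move=> r _; rewrite [- K * _ * _]mulrAC [- K * N r * _]mulrC -mulrDr mulN1r.
  by rewrite -mulrN mulr_ge0 ?expR_ge0 //; have := qN r; lra.
move=> s t /andP[s0 sT] /andP[t0 tT]; rewrite -/(N t) -/(N s).
have T0 : 0 <= T by lra.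
have [st|/ltW ts] := leP s t.
  have := down s t s0 st tT.
  rewrite !mulNr !expRN -ler_pdivlMl ?invr_gt0 ?expR_gt0 // invrK mulrA.
  rewrite -expRN -expRD => /le_trans; apply.
  by rewrite ler_wpM2r // ler_expR -mulrBr ler_pM2l //; lra.
have := up t s t0 ts sT.
rewrite -ler_pdivlMl ?expR_gt0 // mulrA -expRN -expRD => /le_trans; apply.
by rewrite ler_wpM2r // ler_expR addrC -mulrBr ler_pM2l //; lra.
Qed.

(* [F] is built from as many solutions with independent initial values as
   possible, which avoids an existence theorem; by uniqueness every other
   solution is a combination of them. *)
Lemma linear_sol_basis (R : realType) (T : R) (n : nat) (M : 'M[R]_n) :
  0 <= T -> exists r (F : R -> 'M[R]_(n, r)),
  [/\ forall c : 'cV[R]_r, linear_sol T M (fun s => F s *m c),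
      forall c : 'cV[R]_r, F 0 *m c = 0 -> c = 0 &
      forall z, linear_sol T M z ->
        exists c, forall t, 0 <= t <= T -> z t = F t *m c].
Proof.
move=> T0.
pose init v := exists2 z, linear_sol T M z & z 0 = v.
(* [P r] asks for [r] independent initial values of solutions; independence in dimension [n] forces
   [r <= n], so a maximal [r] exists. *)
pose P r := `[< exists E : 'M[R]_(n, r),
  (forall c : 'cV[R]_r, E *m c = 0 -> c = 0) /\ (forall c, init (E *m c)) >].
have initD v w (a : R) : init v -> init w -> init (v + a *: w).
  move=> [z1 z1M <-] [z2 z2M <-].
  by exists (fun s => z1 s + a *: z2 s) => //; exact: linear_solD.
have P0 : exists r, P r.
  exists 0%N; apply/asboolP; exists 0; split=> c; first by rewrite flatmx0.
  rewrite mul0mx; exists (fun=> 0) => // t _ i.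
  by rewrite mulmx0 mxE; exact: deriv_on_cst.
have Pn r : P r -> (r <= n)%N.
  move=> /asboolP[E [Einj _]].
  suff /eqP <- : row_free E^T by exact: rank_leq_col.
  apply: inj_row_free => v vE; apply: trmx_inj; rewrite trmx0; apply: Einj.
  by apply: trmx_inj; rewrite trmx_mul trmxK vE trmx0.
case: (ex_maxnP P0 Pn) => r /asboolP[E [Einj Einit]] rmax.
have /choice[f fP] j : exists z, linear_sol T M z /\ z 0 = E *m delta_mx j 0.
  by have [z zM z0] := Einit (delta_mx j 0); exists z.
pose F s : 'M[R]_(n, r) := \matrix_(i, j) f j s i 0.
have F0 : F 0 = E.
  by apply/matrixP => i j; rewrite mxE (fP j).2 -colE mxE.
have FM c : linear_sol T M (fun s => F s *m c).
  move=> t t0T i.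
  have -> : (M *m (F t *m c)) i 0 = \sum_j c j 0 * (M *m f j t) i 0.
    rewrite mulmxA mxE; apply: eq_bigr => j _; rewrite mulrC !mxE.
    by congr (_ * _); apply: eq_bigr => k _; rewrite mxE.
  rewrite -/(deriv_on T (fun s => (F s *m c) i 0) t _).
  have -> : (fun s => (F s *m c) i 0) = (fun s => \sum_j c j 0 * f j s i 0).
    apply/funext => s; rewrite mxE; apply: eq_bigr => j _.
    by rewrite mxE mulrC.
  apply: deriv_on_sum => j; apply: deriv_onZ.
  exact: (fP j).1 t t0T i.
exists r, F; split=> // [c|z zM]; first by rewrite F0; exact: Einj.
(* Otherwise appending [z 0] to [E] as a further column would contradict the maximality of [r]. *)
have [c zE] : exists c, z 0 = E *m c.
  apply: contrapT => zE.
  suff : P r.+1 by move/rmax; rewrite ltnn.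
  rewrite -addn1; apply/asboolP; exists (row_mx E (z 0)); split=> c.
    rewrite -[c]vsubmxK mul_row_col.
    set u := usubmx c; set d := dsubmx c => ud0.
    have dE : d = (d 0 0)%:M by exact: mx11_scalar.
    (* In a vanishing combination, a nonzero coefficient of [z 0] would let [z 0] be solved for in
       terms of the columns of [E]. *)
    have [d0|d0] := eqVneq (d 0 0) 0.
      move: ud0; rewrite dE d0 raddf0 mulmx0 addr0 => /Einj ->.
      by rewrite col_mx0.
    move: ud0; rewrite dE mul_mx_scalar => /eqP; rewrite addr_eq0 => /eqP uE.
    case: zE; exists (- (d 0 0)^-1 *: u); rewrite -scalemxAr uE.
    by rewrite scaleNr scalerN opprK scalerA mulVf // scale1r.
  rewrite -[c]vsubmxK mul_row_col [dsubmx c]mx11_scalar mul_mx_scalar.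
  by apply: initD => //; exists z.
exists c => t t0T.
(* Uniqueness: the difference of the two solutions vanishes at time 0, hence everywhere. *)
have [K K0 KP] := linear_sol_growth M.
have := KP T _ (linear_solD (a := -1) zM (FM c)) 0 t.
rewrite lexx T0 => /(_ isT t0T).
rewrite zE F0 !scaleN1r subrr sqr_enorm_qform [X in _ * X]sqr_enorm_qform.
rewrite qform0 mulr0 -sqr_enorm_qform => N0.
have /eqP : enorm (z t - F t *m c) ^+ 2 = 0.
  by apply/le_anti; rewrite N0 sqr_ge0.
by rewrite sqrf_eq0 => /eqP/enorm_eq0/eqP; rewrite subr_eq0 => /eqP.
Qed.

(** In the coordinates [c] of the finite-dimensional solution space the increment is a positive
    definite form, hence coercive in [c]; the factor [K ^+ 2] converts [enorm c] into the norm of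
    [z 0 = F 0 *m c]. *)
Lemma linear_sol_coercive (R : realType) (T : R) (n : nat) (M S : 'M[R]_n) :
  0 <= T ->
  (forall z, linear_sol T M z -> z 0 != 0 ->
    0 < qform S (z T) - qform S (z 0)) ->
  exists2 c, 0 < c & forall z, linear_sol T M z ->
    c * enorm (z 0) ^+ 2 <= qform S (z T) - qform S (z 0).
Proof.
move=> T0 pos; have [r [F [FM Finj Fbasis]]] := linear_sol_basis M T0.
pose G t := (F t)^T *m S *m F t.
have GE t c : qform (G t) c = qform S (F t *m c) by rewrite qform_mulmx.
have [k k0 kP] : exists2 k, 0 < k &
    forall c, k * enorm c ^+ 2 <= qform (G T - G 0) c.
  apply: qform_coercive => c c0; rewrite qformB !GE.
  apply: (pos _ (FM c)); apply: contra_neq c0; exact: Finj.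
have [K K0 KP] := enorm_mulmx_bound (F 0).
have K2 : 0 < K ^+ 2 by rewrite exprn_gt0.
exists (k / K ^+ 2); first by rewrite divr_gt0.
move=> z zM; have [c zE] := Fbasis z zM.
rewrite !zE ?lexx ?T0 // -!GE -qformB (le_trans _ (kP c)) //.
rewrite -mulrA ler_pM2l // ler_pdivrMl // -exprMn.
by rewrite ler_pXn2r ?nnegrE ?mulr_ge0 ?enorm_ge0 ?KP // ltW.
Qed.

(** * Exponential decay from unit-step dissipation *)

(** One unit step gives [c * V a <= c * N a <= V (a + 1) - V a], that is, a gain of the factor
    [1 + c]. As many unit steps as fit are made from [a] towards [T], and there [V] is at most
    [N T]. *)
Lemma decay_forward (R : realType) (c T : R) (V N : R -> R) :
  0 < c ->
  (forall s t, 0 <= s -> s <= t -> t <= T -> V s <= V t) ->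
  (forall t, 0 <= t <= T -> `|V t| <= N t) ->
  (forall a s, 0 <= a -> a + 1 <= T -> a <= s <= a + 1 ->
    c * N s <= V (a + 1) - V a) ->
  forall a, 0 <= a <= T -> V a <= expR (ln (1 + c) * (1 - (T - a))) * N T.
Proof.
move=> c0 Vmono VN dissip.
have c1 : 0 < 1 + c by rewrite addr_gt0.
have step k a : 0 <= a -> a + k%:R <= T -> V a <= (1 + c) ^- k * N T.
  elim: k a => [|k IH] a a0.
    rewrite addr0 => aT; rewrite expr0 invr1 mul1r.
    apply: (le_trans (Vmono _ _ a0 aT (lexx T))).
    apply: le_trans (ler_norm _) _.
    by apply: VN; rewrite (le_trans a0 aT) lexx.
  rewrite -natr1 => akT.
  have k0 : 0 <= k%:R :> R by [].
  have Va1 : V (a + 1) <= (1 + c) ^- k * N T by apply: IH; lra.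
  have Va : c * `|V a| <= V (a + 1) - V a.
    have aa : a <= a <= a + 1 by apply/andP; lra.
    have aT : a + 1 <= T by lra.
    apply: le_trans (dissip _ _ a0 aT aa).
    by rewrite ler_pM2l // VN //; apply/andP; lra.
  rewrite exprS invfM -mulrA ler_pdivlMl // mulrDl mul1r.
  have : c * V a <= c * `|V a| by rewrite ler_pM2l // ler_norm.
  by lra.
move=> a /andP[a0 aT].
have NT : 0 <= N T.
  by apply: le_trans (VN T _); rewrite ?normr_ge0 // (le_trans a0 aT) lexx.
have Ta : 0 <= T - a by rewrite subr_ge0.
(* The number [k] of whole steps exceeds [T - a - 1], whence the 1 in the exponent. *)
have /andP[kle klt] := truncn_itv Ta.
set k := Num.truncn (T - a) in kle klt.
apply: (le_trans (step k a a0 _)); first by lra.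
rewrite ler_wpM2r // -[X in X ^- _ <= _](lnK (x := 1 + c)) ?posrE //.
rewrite -expRM_natr -expRN ler_expR -mulrN ler_pM2l.
  by move: klt; rewrite -natr1; lra.
by rewrite ln_gt0 // ltrDl.
Qed.

(** On a unit interval around [t], [c * N t] is at most [V (a + 1) - V a]; the first term is small
    away from [T], the second away from 0. *)
Lemma decay_both (R : realType) (c T : R) (V N : R -> R) :
  0 < c -> 1 <= T ->
  (forall s t, 0 <= s -> s <= t -> t <= T -> V s <= V t) ->
  (forall t, 0 <= t <= T -> `|V t| <= N t) ->
  (forall a s, 0 <= a -> a + 1 <= T -> a <= s <= a + 1 ->
    c * N s <= V (a + 1) - V a) ->
  forall t, 0 <= t <= T -> c * N t <= expR (2 * ln (1 + c)) * (N 0 + N T) *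
    (expR (- (ln (1 + c) * t)) + expR (- (ln (1 + c) * (T - t)))).
Proof.
move=> c0 T1 Vmono VN dissip t /andP[t0 tT].
have fwd := decay_forward c0 Vmono VN dissip.
(* reversing time and the sign of [V] preserves the hypotheses *)
have bwd : forall a, 0 <= a <= T ->
    - V (T - a) <= expR (ln (1 + c) * (1 - (T - a))) * N (T - T).
  apply: (@decay_forward _ c T (fun s => - V (T - s))
    (fun s => N (T - s))) => //.
  - by move=> s r s0 sr rT; rewrite lerN2; apply: Vmono; lra.
  - by move=> s /andP[s0 sT]; rewrite normrN VN //; apply/andP; lra.
  - move=> a s a0 aT /andP[sa sa1].
    have h := dissip (T - (a + 1)) (T - s).
    rewrite (_ : T - (a + 1) + 1 = T - a) in h; last by ring.
    by rewrite opprK [- V _ + _]addrC; apply: h; [lra|lra|apply/andP; lra].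
set mu := ln (1 + c) in fwd bwd *.
have mu0 : 0 < mu by rewrite ln_gt0 // ltrDl.
have N0 s : 0 <= s <= T -> 0 <= N s.
  by move=> s0T; apply: le_trans (VN s s0T); exact: normr_ge0.
(* This choice puts [t] in [[a, a + 1]] and keeps that interval inside [[0, T]]. *)
pose a := Num.min t (T - 1).
have at_ : a <= t by rewrite ge_min lexx.
have aT : a <= T - 1 by rewrite ge_min lexx orbT.
have a0 : 0 <= a by rewrite le_min t0; lra.
have ta : t <= a + 1 by rewrite -lerBlDr le_min; apply/andP; lra.
apply: le_trans (dissip a t a0 _ _) _; [lra|by apply/andP; lra|].
(* One [mu] in [2 * mu] pays for rounding to whole steps, the other for replacing [a + 1] by [t], as
   [a <= t]. The bound on [- V a] uses [t <= a + 1] likewise. *)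
have Va1 : V (a + 1) <= expR (2 * mu) * expR (- (mu * (T - t))) * N T.
  apply: le_trans (fwd (a + 1) _) _; first by apply/andP; lra.
  rewrite ler_wpM2r ?N0 ?lexx ?andbT //; first lra.
  by rewrite -expRD ler_expR [2 * mu]mulrC -mulrN -mulrDr ler_pM2l //; lra.
have Va : - V a <= expR (2 * mu) * expR (- (mu * t)) * N 0.
  have := bwd (T - a); rewrite subrr subKr => /(_ _)/le_trans; apply.
    by apply/andP; lra.
  rewrite ler_wpM2r ?N0 ?lexx ?andTb //; first lra.
  by rewrite -expRD ler_expR [2 * mu]mulrC -mulrN -mulrDr ler_pM2l //; lra.
have e1 := expR_ge0 (2 * mu).
have N00 : 0 <= N 0 by apply: N0; apply/andP; lra.
have NTT : 0 <= N T by apply: N0; apply/andP; lra.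
have h1 := mulr_ge0 (mulr_ge0 e1 (expR_ge0 (- (mu * (T - t))))) N00.
have h2 := mulr_ge0 (mulr_ge0 e1 (expR_ge0 (- (mu * t)))) NTT.
apply: le_trans (lerD Va1 Va) _; rewrite -subr_ge0.
(* Only the nonnegative cross terms of the expanded product are left. *)
rewrite (_ : _ - _ = expR (2 * mu) * expR (- (mu * (T - t))) * N 0 +
  expR (2 * mu) * expR (- (mu * t)) * N T); last by ring.
exact: addr_ge0 h1 h2.
Qed.

(** * The Hamiltonian system *)

(** The system is autonomous; constants found on [[0, 1]] thus serve on every unit interval. *)
Lemma linear_sol_shift (R : realType) (T S a : R) (n : nat) (M : 'M[R]_n) z :
  0 <= a -> a + S <= T -> linear_sol T M z ->
  linear_sol S M (fun s => z (a + s)).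
Proof.
move=> a0 aT zM t /andP[t0 tS] i.
have atT : 0 <= a + t <= T by apply/andP; lra.
exact: (deriv_on_shift (f := fun s => z s i 0) a0 aT (zM _ atT i)).
Qed.

Lemma sqr_enorm_col_mx (R : realType) (m n : nat) (u : 'cV[R]_m)
    (v : 'cV[R]_n) : enorm (col_mx u v) ^+ 2 = enorm u ^+ 2 + enorm v ^+ 2.
Proof.
rewrite !sqr_enorm big_split_ord /=.
by congr (_ + _); apply: eq_bigr => i _; rewrite ?col_mxEu ?col_mxEd.
Qed.

Lemma qform_invmx_gt0 (R : realType) (n : nat) (U : 'M[R]_n) :
  sym_posdef U -> forall w, w != 0 -> 0 < qform (invmx U) w.
Proof.
move=> hU w w0; have [Usym Upos] := hU; have Uu := posdef_unitmx hU.
have -> : qform (invmx U) w = qform U (invmx U *m w).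
  by rewrite qform_mulmx trmx_inv Usym mulVmx // mul1mx.
apply: Upos; apply: contra_neq w0 => Uw.
by rewrite -(mulKVmx Uu w) Uw mulmx0.
Qed.

Lemma qform_ge0 (R : realType) (n : nat) (S : 'M[R]_n) :
  (forall v, v != 0 -> 0 < qform S v) -> forall v, 0 <= qform S v.
Proof.
move=> Spos v; have [->|/Spos/ltW//] := eqVneq v 0.
by rewrite qform0.
Qed.

Section Hamiltonian.
Variables (R : realType) (n m : nat).
Variables (A : 'M[R]_n) (B : 'M[R]_(n, m)) (Q : 'M[R]_n) (U : 'M[R]_m).
Hypotheses (hQ : sym_posdef Q) (hU : sym_posdef U) (hAB : kalman A B).

Definition hamiltonian_mx : 'M[R]_(n + n) :=
  block_mx A (B *m invmx U *m B^T) Q (- A^T).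

(* The quadratic form of this matrix is [(y, p) |-> y^T p]. *)
Definition pairing_mx : 'M[R]_(n + n) := block_mx 0 1%:M 0 0.

Lemma qform_pairing y p : qform pairing_mx (col_mx y p) = (y^T *m p) 0 0.
Proof.
rewrite /qform /pairing_mx tr_col_mx mul_row_block mul_row_col.
by rewrite !mulmx0 !addr0 mul0mx add0r mulmx1.
Qed.

(** Young's inequality with a free weight: [a = 1] compares the pairing with [|z|^2], and
    [a = 2 / c] later makes the costate part absorbable. *)
Lemma qform_pairing_bound a z : 0 < a ->
  `|qform pairing_mx z| <=
    a / 2 * enorm (usubmx z) ^+ 2 + (2 * a)^-1 * enorm (dsubmx z) ^+ 2.
Proof.
move=> a0; rewrite -{1}[z]vsubmxK qform_pairing mul_rowcolE !sqr_enorm.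
apply: le_trans (ler_norm_sum _ _ _) _.
rewrite !mulr_sumr -big_split ler_sum //= => i _.
set x := usubmx z i 0; set w := dsubmx z i 0.
have a2 : 0 < 2 * a by rewrite mulr_gt0.
have xw : `|x * w| * (2 * a) <= a ^+ 2 * x ^+ 2 + w ^+ 2.
  rewrite -[2 * a]gtr0_norm // -normrM ler_norml; apply/andP; split.
    have := sqr_ge0 (a * x + w); lra.
  have := sqr_ge0 (a * x - w); lra.
rewrite -(ler_pM2r a2); apply: le_trans xw _.
by rewrite le_eqVlt; apply/orP; left; apply/eqP; field; rewrite gt_eqF.
Qed.

(** The left side is the derivative of the pairing along solutions; the contributions of [A^T] from
    the two products cancel. *)
Lemma qform_dissipation z :
  qform (hamiltonian_mx^T *m pairing_mx + pairing_mx *m hamiltonian_mx) z =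
  qform Q (usubmx z) + qform (invmx U) (B^T *m dsubmx z).
Proof.
have Uinv : (invmx U)^T = invmx U by rewrite trmx_inv hU.1.
rewrite /hamiltonian_mx /pairing_mx tr_block_mx !mulmx_block.
rewrite !mulmx0 !mul0mx !mul1mx !mulmx1 !addr0 !add0r add_block_mx.
rewrite subrr !add0r addr0 -{1}[z]vsubmxK /qform tr_col_mx mul_row_block.
rewrite !mulmx0 !addr0 add0r mul_row_col mxE; congr (_ + _).
by rewrite !trmx_mul !trmxK Uinv !mulmxA.
Qed.

Lemma qform_dissipation_ge0 z :
  0 <= qform (hamiltonian_mx^T *m pairing_mx + pairing_mx *m hamiltonian_mx) z.
Proof.
rewrite qform_dissipation addr_ge0 //; apply: qform_ge0; first exact: hQ.2.
exact: qform_invmx_gt0.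
Qed.

Lemma qform_dissipation_eq0 z :
  qform (hamiltonian_mx^T *m pairing_mx + pairing_mx *m hamiltonian_mx) z = 0 ->
  usubmx z = 0 /\ B^T *m dsubmx z = 0.
Proof.
have UP := qform_invmx_gt0 hU.
rewrite qform_dissipation => /eqP; rewrite paddr_eq0; last 2 first.
- exact: qform_ge0 hQ.2 _.
- exact: qform_ge0 UP _.
move=> /andP[y0 p0]; split; apply/eqP.
  by apply: contraTT y0 => /hQ.2; rewrite lt_def => /andP[].
by apply: contraTT p0 => /UP; rewrite lt_def => /andP[].
Qed.

(** Such a [p] annihilates the Kalman matrix from the left, and full rank makes the rows of that
    matrix independent. *)
Lemma kalman_inj (p : 'cV[R]_n) :
  (forall k, (A ^+ k *m B)^T *m p = 0) -> p = 0.
Proof.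
move=> Bp; apply: trmx_inj; rewrite trmx0.
apply: (@row_free_inj _ _ _ _ (\mxrow_(k < n) (A ^+ k *m B))) => /=.
  by rewrite /row_free hAB.
rewrite mul0mx mul_mxrow -[RHS](mxrow0 1); apply: eq_mxrow => k.
by apply: trmx_inj; rewrite trmx_mul trmxK Bp trmx0.
Qed.

Lemma hamiltonian_sol_nondecreasing T z : linear_sol T hamiltonian_mx z ->
  forall s t, 0 <= s -> s <= t -> t <= T ->
  qform pairing_mx (z s) <= qform pairing_mx (z t).
Proof.
move=> zH s t; apply: (@deriv_on_nondecreasing _ T
  (fun r => qform pairing_mx (z r)) (fun r => qform
    (hamiltonian_mx^T *m pairing_mx + pairing_mx *m hamiltonian_mx) (z r))).
  by move=> r r0T; exact: linear_sol_qform.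
by move=> r _; exact: qform_dissipation_ge0.
Qed.

Lemma hamiltonian_sol_gt0 z : linear_sol 1 hamiltonian_mx z -> z 0 != 0 ->
  0 < qform pairing_mx (z 1) - qform pairing_mx (z 0).
Proof.
move=> zH; rewrite subr_gt0; apply: contra_neqT; rewrite -leNgt => V10.
have Vmono := hamiltonian_sol_nondecreasing zH.
(* A nondecreasing function that ends no higher than it starts is constant, so the dissipation
   vanishes on the open interval. *)
have Vcst s : 0 < s < 1 -> qform pairing_mx (z s) = qform pairing_mx (z 0).
  move=> /andP[/ltW s0 /ltW s1]; apply/le_anti/andP; split.
    exact: le_trans (Vmono _ _ s0 s1 (lexx 1)) V10.
  exact: Vmono.
have zD t : 0 < t < 1 -> usubmx (z t) = 0 /\ B^T *m dsubmx (z t) = 0.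
  move=> t01; apply: qform_dissipation_eq0.
  apply: (deriv_on_cst_eq0 t01 Vcst); apply: linear_sol_qform => //.
  by case/andP: t01 => /ltW -> /ltW ->.
(* Where [y = 0] the costate solves [p' = - A^T p]; differentiating the identity for [k] gives the
   one for [k + 1] up to sign. *)
have Bp k : forall t, 0 < t < 1 -> (A ^+ k *m B)^T *m dsubmx (z t) = 0.
  elim: k => [|k IH] t t01; first by rewrite expr0 mul1mx (zD t t01).2.
  have t01w : 0 <= t <= 1 by case/andP: t01 => /ltW -> /ltW ->.
  have dz : has_deriv_on 1 (fun s => dsubmx (z s)) t (- A^T *m dsubmx (z t)).
    move=> i; have := zH t t01w (rshift n i).
    have -> : (hamiltonian_mx *m z t) (rshift n i) 0 =
        (- A^T *m dsubmx (z t)) i 0.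
      rewrite -[z t in LHS]vsubmxK mul_block_col col_mxEd (zD t t01).1.
      by rewrite mulmx0 add0r.
    rewrite -/(deriv_on 1 (fun s => dsubmx (z s) i 0) t _).
    have -> // : (fun s => dsubmx (z s) i 0) = (fun s => z s (rshift n i) 0).
    by apply/funext => s; rewrite mxE.
  apply/matrixP => i j; rewrite ord1 [RHS]mxE.
  have dv : deriv_on 1 (fun s => ((A ^+ k *m B)^T *m dsubmx (z s)) i 0) t
      (((A ^+ k *m B)^T *m (- A^T *m dsubmx (z t))) i 0).
    by move: i; exact: has_deriv_on_mulmx dz.
  have Bp0 s : 0 < s < 1 -> ((A ^+ k *m B)^T *m dsubmx (z s)) i 0 = 0.
    by move=> s01; rewrite IH // mxE.
  apply/eqP; rewrite -oppr_eq0 -(deriv_on_cst_eq0 t01 Bp0 dv) exprS -mulmxA.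
  rewrite [in X in - X]trmx_mul.
  by rewrite -mulmxA mulNmx mulmxN [eqbRHS]mxE.
(* The identities hold at interior times only: [z] vanishes at [1/2], and the growth estimate
   carries this back to time 0. *)
have h01 : 0 < (2^-1 : R) < 1 by apply/andP; lra.
have [K K0 KP] := linear_sol_growth hamiltonian_mx.
have := KP 1 z zH (2^-1) 0; rewrite lexx ler01 => /(_ _ isT).
rewrite -[z 2^-1]vsubmxK (zD _ h01).1 (kalman_inj (fun k => Bp k _ h01)).
rewrite col_mx0 [X in _ * X]sqr_enorm_qform qform0 mulr0 => z0.
apply: enorm_eq0; apply/eqP; rewrite -sqrf_eq0 eq_le sqr_ge0 andbT.
by apply: z0; apply/andP; lra.
Qed.

(** After translation to [[0, 1]], coercivity controls [z a], and the growth estimate passes from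
    [z a] to [z s] at the price of a fixed factor. *)
Lemma hamiltonian_dissipation : exists2 c, 0 < c &
  forall T z, linear_sol T hamiltonian_mx z ->
    forall a s, 0 <= a -> a + 1 <= T -> a <= s <= a + 1 ->
    c * enorm (z s) ^+ 2 <=
      qform pairing_mx (z (a + 1)) - qform pairing_mx (z a).
Proof.
have [c c0 cP] := linear_sol_coercive ler01 hamiltonian_sol_gt0.
have [K K0 KP] := linear_sol_growth hamiltonian_mx.
exists (c / expR (K * 1)); first by rewrite divr_gt0 ?expR_gt0.
move=> T z zH a s a0 aT /andP[sa sa1].
have z1 := linear_sol_shift a0 aT zH.
have := cP _ z1; rewrite addr0; apply: le_trans.
rewrite -mulrA ler_pM2l // ler_pdivrMl ?expR_gt0 //.
have := KP 1 _ z1 0 (s - a); rewrite /= addr0 subrKC lexx ler01.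
by apply=> //; apply/andP; lra.
Qed.


Lemma hamiltonian_boundary c T z : 0 < c -> 1 <= T ->
  linear_sol T hamiltonian_mx z ->
  (forall a s, 0 <= a -> a + 1 <= T -> a <= s <= a + 1 ->
    c * enorm (z s) ^+ 2 <=
      qform pairing_mx (z (a + 1)) - qform pairing_mx (z a)) ->
  c ^+ 2 * (enorm (z 0) ^+ 2 + enorm (z T) ^+ 2) <=
    4 * (enorm (usubmx (z 0)) + enorm (usubmx (z T))) ^+ 2.
Proof.
move=> c0 T1 zH dissip.
have Vmono := hamiltonian_sol_nondecreasing zH.
set V := fun t => qform pairing_mx (z t) in dissip Vmono.
have E0 : c * enorm (z 0) ^+ 2 <= V T - V 0.
  apply: le_trans (dissip 0 0 _ _ _) _; rewrite ?add0r ?lexx ?ler01 //.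
  by rewrite lerD2r; apply: Vmono; lra.
have ET : c * enorm (z T) ^+ 2 <= V T - V 0.
  apply: le_trans (dissip (T - 1) T _ _ _) _; rewrite ?subrK ?lexx //.
  - by rewrite subr_ge0.
  - by rewrite andbT lerBlDr lerDl.
  - by rewrite lerD2l lerN2; apply: Vmono; lra.
(* With this weight the costate terms carry the factor [c / 4], so by [E0] and [ET] they add up to
   at most half of [V T - V 0] and can be absorbed. *)
have b0 : 0 < 2 / c by rewrite divr_gt0.
have := qform_pairing_bound (z 0) b0; have := qform_pairing_bound (z T) b0.
rewrite -/(V 0) -/(V T) !ler_norml => /andP[_ VT] /andP[V0 _].
have zE t : enorm (z t) ^+ 2 =
    enorm (usubmx (z t)) ^+ 2 + enorm (dsubmx (z t)) ^+ 2.
  by rewrite -sqr_enorm_col_mx vsubmxK.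
rewrite !zE in E0 ET *.
have := enorm_ge0 (usubmx (z 0)); have := enorm_ge0 (usubmx (z T)).
move: VT V0 E0 ET; have -> : 2 / c / 2 = c^-1 by field; rewrite gt_eqF.
have -> : (2 * (2 / c))^-1 = c / 4 by field; rewrite gt_eqF.
set y0 := enorm (usubmx (z 0)); set y1 := enorm (usubmx (z T)).
set p0 := enorm (dsubmx (z 0)) ^+ 2; set p1 := enorm (dsubmx (z T)) ^+ 2.
move=> VT V0 E0 ET y10 y00.
have E4 : V T - V 0 <= 2 * c^-1 * (y0 ^+ 2 + y1 ^+ 2).
  have := mulr_ge0 (ltW c0) (sqr_ge0 y0).
  have := mulr_ge0 (ltW c0) (sqr_ge0 y1).
  lra.
have E5 : c * (V T - V 0) <= 2 * (y0 ^+ 2 + y1 ^+ 2).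
  by rewrite mulrC -ler_pdivlMr // mulrAC.
have := mulr_ge0 y00 y10.
have := ler_wpM2l (ltW c0) E0; have := ler_wpM2l (ltW c0) ET.
lra.
Qed.

Lemma hamiltonian_turnpike : exists C nu : R, [/\ 0 < C, 0 < nu &
  forall T z, 1 <= T -> linear_sol T hamiltonian_mx z ->
    forall t, 0 <= t <= T -> enorm (z t) <=
      C * (enorm (usubmx (z 0)) + enorm (usubmx (z T))) *
      (expR (- (nu * t)) + expR (- (nu * (T - t))))].
Proof.
have [c c0 cP] := hamiltonian_dissipation.
pose mu := ln (1 + c).
have mu0 : 0 < mu by rewrite ln_gt0 // ltrDl.
(* One factor [c] comes from the decay estimate and two from the boundary estimate. Both concern
   [|z|^2], hence the square root of [C2] and the halved rate [mu / 2]. *)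
pose C2 := 4 * expR (2 * mu) / c ^+ 3.
have C20 : 0 < C2 by rewrite !mulr_gt0 ?invr_gt0 ?exprn_gt0 ?expR_gt0.
exists (Num.sqrt C2), (mu / 2); split; [by rewrite sqrtr_gt0|lra|].
move=> T z T1 zH t t0T.
have bnd := hamiltonian_boundary c0 T1 zH (cP T z zH).
have VN s : 0 <= s <= T -> `|qform pairing_mx (z s)| <= enorm (z s) ^+ 2.
  move=> _; apply: le_trans (qform_pairing_bound (z s) ltr01) _.
  rewrite -{3}[z s]vsubmxK sqr_enorm_col_mx.
  have := sqr_ge0 (enorm (usubmx (z s))).
  by have := sqr_ge0 (enorm (dsubmx (z s))); lra.
have dec := decay_both (V := fun s => qform pairing_mx (z s))
  (N := fun s => enorm (z s) ^+ 2) c0 T1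
  (hamiltonian_sol_nondecreasing zH) VN (cP T z zH) t0T.
rewrite -/mu in dec.
set Y := enorm (usubmx (z 0)) + _ in bnd *.
set e1 := expR (- (mu / 2 * t)); set e2 := expR (- (mu / 2 * (T - t))).
have Ee1 : expR (- (mu * t)) = e1 ^+ 2.
  by rewrite expr2 -expRD; congr expR; field.
have Ee2 : expR (- (mu * (T - t))) = e2 ^+ 2.
  by rewrite expr2 -expRD; congr expR; field.
rewrite Ee1 Ee2 in dec.
have Y0 : 0 <= Y by rewrite addr_ge0 ?enorm_ge0.
have e10 : 0 <= e1 := expR_ge0 _; have e20 : 0 <= e2 := expR_ge0 _.
rewrite -(@ler_pXn2r _ 2) ?nnegrE ?enorm_ge0 //; last first.
  by rewrite !mulr_ge0 ?sqrtr_ge0 // addr_ge0.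
rewrite !exprMn (sqr_sqrtr (ltW C20)).
rewrite -(ler_pM2l (exprn_gt0 3 c0)).
have -> : c ^+ 3 * (C2 * Y ^+ 2 * (e1 + e2) ^+ 2) =
    expR (2 * mu) * (4 * Y ^+ 2) * (e1 + e2) ^+ 2.
  by rewrite /C2; field; rewrite gt_eqF.
apply: (@le_trans _ _ (expR (2 * mu) *
    (c ^+ 2 * (enorm (z 0) ^+ 2 + enorm (z T) ^+ 2)) * (e1 ^+ 2 + e2 ^+ 2))).
  rewrite exprS mulrAC [c * _ * _]mulrC.
  apply: le_trans (ler_wpM2l (sqr_ge0 c) dec) _.
  by rewrite le_eqVlt; apply/orP; left; apply/eqP; ring.
have E0 := expR_ge0 (2 * mu).
apply: ler_pM.
- by apply: mulr_ge0 => //; apply: mulr_ge0; rewrite ?addr_ge0 ?sqr_ge0.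
- by rewrite addr_ge0 ?sqr_ge0.
- by rewrite ler_wpM2l.
by have := mulr_ge0 e10 e20; lra.
Qed.

End Hamiltonian.

(** * Reduction of the extremal system to the Hamiltonian system *)

(** Subtracting the static equations cancels the constant terms in [ud] and [xd], so the deviations
    solve the homogeneous system. *)
Lemma costate_hamiltonian (R : realType) (n m : nat)
    (A : 'M[R]_n) (B : 'M[R]_(n, m)) (Q : 'M[R]_n) (U : 'M[R]_m) xd ud xbar
    ubar lbar T x u l :
  static_multiplier A B Q U xd ud xbar ubar lbar ->
  costate A B Q U xd ud T x u l ->
  linear_sol T (hamiltonian_mx A B Q U)
    (fun t => col_mx (x t - xbar) (l t - lbar)).
Proof.
move=> [xE lE _] cost t t0T i; have [_ dx dl] := cost t t0T.
rewrite mul_block_col.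
have shift k (f : R -> 'cV[R]_k) (v w : 'cV[R]_k) :
    has_deriv_on T f t w -> has_deriv_on T (fun s => f s - v) t w.
  move=> fw; rewrite -[w]addr0; apply: has_deriv_onD fw _.
  move=> j; have -> : (0 : 'cV[R]_k) j 0 = 0 by rewrite mxE.
  exact: (@deriv_on_cst _ T ((- v) j 0) t).
have dy : has_deriv_on T (fun s => x s - xbar) t
    (A *m (x t - xbar) + B *m invmx U *m B^T *m (l t - lbar)).
  have -> : A *m (x t - xbar) + B *m invmx U *m B^T *m (l t - lbar) =
      A *m x t + B *m invmx U *m B^T *m l t + B *m ud.
    rewrite !mulmxBr -[RHS]subr0 -xE [in RHS]opprD [in RHS]addrACA subrr addr0.
    by rewrite [in RHS]opprD [in RHS]addrACA.
  exact: shift dx.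
have dp : has_deriv_on T (fun s => l s - lbar) t
    (Q *m (x t - xbar) + - A^T *m (l t - lbar)).
  have -> : Q *m (x t - xbar) + - A^T *m (l t - lbar) =
      Q *m x t - A^T *m l t - Q *m xd.
    rewrite mulNmx !mulmxBr -[RHS]subr0 -lE [in RHS]opprD [in RHS]addrACA.
    rewrite subrr addr0.
    by rewrite [in RHS]opprD [in RHS]addrACA [in LHS]opprD.
  exact: shift dl.
rewrite -/(deriv_on T (fun s => col_mx (x s - xbar) (l s - lbar) i 0) t _).
case: (split_ordP i) => k ->.
  rewrite col_mxEu.
  apply: (deriv_on_ext (f := fun s => (x s - xbar) k 0)) => //.
    by move=> s _; rewrite col_mxEu.
  exact: dy.
rewrite col_mxEd; apply: (deriv_on_ext (f := fun s => (l s - lbar) k 0)) => //.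
  by move=> s _; rewrite col_mxEd.
exact: dp.
Qed.

Theorem theorem1 (R : realType) (n m : nat) (hn : (1 <= n)%N) (hm : (1 <= m)%N)
    (A : 'M[R]_n) (B : 'M[R]_(n, m)) (Q : 'M[R]_n) (U : 'M[R]_m)
    (hQ : sym_posdef Q) (hU : sym_posdef U) (hAB : kalman A B) :
  exists T0 C nu : R,
    [/\ 0 < T0, 0 < C, 0 < nu &
      forall (xd : 'cV[R]_n) (ud : 'cV[R]_m)
        (xbar : 'cV[R]_n) (ubar : 'cV[R]_m) (lbar : 'cV[R]_n),
        static_minimizer A B Q U xd ud xbar ubar ->
        static_multiplier A B Q U xd ud xbar ubar lbar ->
      forall (T : R) (x0 x1 : 'cV[R]_n), T0 <= T ->
      forall (xT : R -> 'cV[R]_n) (uT : R -> 'cV[R]_m) (lT : R -> 'cV[R]_n),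
        optimal_pair A B Q U xd ud T x0 x1 xT uT ->
        costate A B Q U xd ud T xT uT lT ->
      forall t : R, 0 <= t <= T ->
        enorm (xT t - xbar) + enorm (uT t - ubar) + enorm (lT t - lbar)
        <= C * (enorm (x0 - xbar) + enorm (x1 - xbar))
             * (expR (- (nu * t)) + expR (- (nu * (T - t))))].
Proof.
have [C [nu [C0 nu0 bound]]] := hamiltonian_turnpike hQ hU hAB.
have [K K0 KP] := enorm_mulmx_bound (invmx U *m B^T).
(* [T0 = 1] leaves room for a unit interval. The state and costate deviations each cost one
   [enorm z], and the control deviation [U^-1 B^T (l - lbar)] costs [K] of them. *)
exists 1, ((2 + K) * C), nu; split=> //; first by rewrite mulr_gt0 // addr_gt0.
move=> xd ud xbar ubar lbar _ mult T x0 x1 T1 xT uT lT.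
move=> [[_ _ _ <- <-] _] cost t t0T.
have zH := costate_hamiltonian mult cost.
have := bound T _ T1 zH t t0T; rewrite /= !col_mxKu => zt.
set z := col_mx _ _ in zt.
have zE : enorm z ^+ 2 = enorm (xT t - xbar) ^+ 2 + enorm (lT t - lbar) ^+ 2.
  exact: sqr_enorm_col_mx.
have yz : enorm (xT t - xbar) <= enorm z.
  by rewrite -(@ler_pXn2r _ 2) ?nnegrE ?enorm_ge0 // zE lerDl sqr_ge0.
have pz : enorm (lT t - lbar) <= enorm z.
  by rewrite -(@ler_pXn2r _ 2) ?nnegrE ?enorm_ge0 // zE lerDr sqr_ge0.
have uE : uT t - ubar = invmx U *m B^T *m (lT t - lbar).
  have [-> _ _] := cost t t0T; have [_ _ ->] := mult.
  by rewrite opprD addrACA subrr add0r mulmxBr.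
have uz : enorm (uT t - ubar) <= K * enorm z.
  by rewrite uE (le_trans (KP _)) // ler_pM2l.
have K2 : 0 < 2 + K by rewrite addr_gt0.
apply: (@le_trans _ _ ((2 + K) * enorm z)); first by lra.
by apply: le_trans (ler_wpM2l (ltW K2) zt) _; rewrite !mulrA.
Qed.
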